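(* There exist universal constants $K_1,K_2>0$ such that the following holds. Let $(V,E)$ be a graph with vertex set $V$ and edge set $E$, let $(X_e)_{e\in E}$ be independent positive random variables distributed like a given random variable $X$, and let $\mathcal S$ be a family of sets of edges. Put $r=\sup_{S\in\mathcal S}\mathrm{card}\,S$ and $$Z'_{\mathcal S}=\inf_{S\in\mathcal S}\ \sum_{e\in S}X_e ,$$ and let $M$ be a median of $Z'_{\mathcal S}$. If $E\exp(X/K_1)\le2$, then for all $u>0$, $$P(|Z'_{\mathcal S}-M|\ge u)\le4\exp\Big(-\frac1{K_2}\min\Big(\frac{u^2}{r},u\Big)\Big).$$
   Context: Here $r$ is understood to be finite.
   Formalization: The family of edge sets is assumed nonempty and countable (automatic when the edge set is countable, since r is finite); for uncountable families the claim fails, since changing each variable on a null event can change the infimum with positive probability. *)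

(* Defs.v *)
From HB Require Import structures.
From mathcomp Require Import all_boot all_order all_algebra.
From mathcomp Require Import finmap.
From mathcomp Require Import all_classical all_reals all_analysis.

Set Implicit Arguments.
Unset Strict Implicit.
Unset Printing Implicit Defensive.

Import Order.TTheory GRing.Theory Num.Theory.
Import numFieldNormedType.Exports.

Local Open Scope classical_set_scope.
Local Open Scope ring_scope.

(* The vertex set is all of V; V may be infinite. *)
Definition simple_graph (V : Type) (E : set (set V)) : Prop :=
  forall e, E e -> exists x y : V, x <> y /\ e = [set x; y].

Definition mutually_independent (d : measure_display) (T : measurableType d)
    (R : realType) (P : probability T R) (I : choiceType) (D : set I)
    (X : I -> {RV P >-> R}) : Prop :=
  forall (J : {fset I}) (B : I -> set R),
    [set` J] `<=` D -> (forall i, i \in J -> measurable (B i)) ->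
    P (\bigcap_(i in [set` J]) (X i @^-1` B i)) =
    (\prod_(i <- J) P (X i @^-1` B i))%E.

(* The two variables may live on different probability spaces. Only measurable
   sets are compared, the value of a measure elsewhere being unspecified. *)
Definition same_distribution (d d' : measure_display) (T : measurableType d)
    (T' : measurableType d') (R : realType) (P : probability T R)
    (P' : probability T' R) (X : {RV P >-> R}) (Y : {RV P' >-> R}) : Prop :=
  forall B : set R, measurable B -> distribution P X B = distribution P' Y B.

Definition is_median (d : measure_display) (T : measurableType d)
    (R : realType) (P : probability T R) (Z : T -> R) (m : R) : Prop :=
  ((2^-1)%:E <= P [set w | (Z w <= m)%R])%E /\
  ((2^-1)%:E <= P [set w | (m <= Z w)%R])%E.

(* [counting A] is +oo when A is infinite, so that sup_card R F < +oo forces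
   every member of F to be finite. *)
Definition sup_card (R : realType) (I : choiceType) (F : set (set I)) : \bar R :=
  ereal_sup [set counting A | A in F].

(* A genuine infimum of finite sums when F is nonempty, its members are finite
   and X is nonnegative; the operators return junk values otherwise. *)
Definition passage_time (T : Type) (R : realType) (I : choiceType)
    (X : I -> T -> R) (F : set (set I)) (w : T) : R :=
  inf [set \sum_(e \in A) X e w | A in F].

(* Main.v *)
(* The entropy method. On a finite product space, entropy is subadditive: it is at most the sum of the
   one-coordinate covariances of [f] and [ln f]. For [f = exp (l Z)], pair each configuration with the one obtained by
   resampling coordinate [i], and call [x] the member of the pair with the smaller [Z]. Then the increment of [Z] is at
   most the resampled value, and vanishes unless [i] belongs to an optimal set of [x]. At most [r] coordinates thus
   contribute, whence [Ent (exp (l Z)) <= 16 r l^2 E exp (l Z)] for [|l| <= 1/2], whatever the sign of [l]. Convexity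
   turns this into [L l <= 2 L (l/2) + 16 r l^2] for [L = ln E exp (l Z)], and iteration of this inequality into
   [L l <= l E Z + 32 r l^2]. Markov's inequality on both sides gives
     P(Z <= a) P(b <= Z) <= exp (64 r l^2 - l (b - a)),
   in which the mean no longer appears. The last bound passes to general variables by discretization, to countable
   families by monotone continuity, and yields the claim with [a] or [b] the median and [l = min(u/(128 r), 1/2)]. *)
Require Import Defs.
From HB Require Import structures.
From mathcomp Require Import all_boot all_order all_algebra.
From mathcomp Require Import finmap.
From mathcomp Require Import all_classical all_reals all_analysis.
From mathcomp Require Import measurable_realfun.
From mathcomp Require Import ring lra.

Set Implicit Arguments.
Unset Strict Implicit.
Unset Printing Implicit Defensive.

Import Order.TTheory GRing.Theory Num.Theory.
Import numFieldNormedType.Exports.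

Local Open Scope classical_set_scope.
Local Open Scope ring_scope.

(** * Elementary bounds on the exponential, and a covariance inequality for logarithms *)

Section ExponentialBounds.
Context {R : realType}.

Lemma normr_expR_sub1 (t : R) : `|expR t - 1| <= `|t| * expR `|t|.
Proof.
have bound s : expR s - 1 <= s * expR s.
  have := ler_wpM2l (expR_ge0 s) (expR_ge1Dx (- s)); rewrite expRxMexpNx_1; lra.
have [t0|t0] := leP 0 t.
  rewrite (ger0_norm t0) ger0_norm ?bound// subr_ge0.
  by rewrite -[leLHS]expR0 ler_expR.
rewrite (ltr0_norm t0) ltr0_norm ?subr_lt0 ?expR_lt1//.
have et : 1 <= expR (- t) by rewrite -[leLHS]expR0 ler_expR oppr_ge0 ltW.
have := expR_ge1Dx t; have : - t * 1 <= - t * expR (- t).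
  by rewrite ler_wpM2l// oppr_ge0 ltW.
by lra.
Qed.

Lemma expR_le_quadratic (t : R) : expR t <= 1 + t + t ^+ 2 * expR `|t|.
Proof.
have -> : t ^+ 2 = `|t| * `|t| by rewrite -expr2 real_normK ?num_real.
have key : t * (expR t - 1) <= `|t| * `|t| * expR `|t|.
  rewrite (le_trans (ler_norm _))// normrM -mulrA ler_wpM2l//.
  exact: normr_expR_sub1.
suff : expR t - 1 <= t * expR t by lra.
by have := ler_wpM2l (expR_ge0 t) (expR_ge1Dx (- t)); rewrite expRxMexpNx_1; lra.
Qed.

(** Here [t] stands for an increment of the passage time and [v] for the resampled value. As
    [|l| <= 1/2], half of the exponent [v] pays for the exponential factor; the other half absorbs
    [t ^+ 2], since [expR (v / 2) >= 1 + v ^+ 2 / 8]. *)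
Lemma mulr_expR_sub1_le (t v l : R) :
  0 <= t -> t <= v -> `|l| <= 2^-1 ->
  (l * t) * (expR (l * t) - 1) <= 8 * l ^+ 2 * expR v.
Proof.
move=> t0 tv l2.
have v0 : 0 <= v := le_trans t0 tv.
apply: (@le_trans _ _ (l ^+ 2 * t ^+ 2 * expR (v / 2))).
  rewrite (le_trans (ler_norm _))// normrM -exprMn.
  apply: (@le_trans _ _ (`|l * t| * (`|l * t| * expR `|l * t|))).
    by rewrite ler_wpM2l ?normr_expR_sub1.
  rewrite mulrA -expr2 real_normK ?num_real// ler_wpM2l ?sqr_ge0// ler_expR.
  by rewrite normrM (ger0_norm t0); nra.
have -> : expR v = expR (v / 2) * expR (v / 2) by rewrite -expRD; congr expR; lra.
have v2 : t ^+ 2 <= 8 * expR (v / 2).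
  have := @expR_ge1Dxn R (v / 2) 1 (divr_ge0 v0 (ler0n _ _)).
  rewrite (_ : 2`! = 2)%N//.
  have : t ^+ 2 <= v ^+ 2 by rewrite lerXn2r ?nnegrE.
  by rewrite expr_div_n; lra.
rewrite (_ : 8 * _ * _ = l ^+ 2 * (8 * expR (v / 2)) * expR (v / 2)); last by ring.
by rewrite ler_wpM2r ?expR_ge0// ler_wpM2l ?sqr_ge0.
Qed.

(* The variational formula for entropy (applied to [ln b] minus its log-mean), followed by Jensen for [ln]. *)
Lemma covariance_ge_log_gain (K : finType) (q a b : K -> R) :
  (forall k, 0 <= q k) -> \sum_k q k = 1 ->
  (forall k, 0 < a k) -> (forall k, 0 < b k) ->
  0 < \sum_k q k * a k -> 0 < \sum_k q k * b k ->
  \sum_k q k * (a k * (ln (b k) - ln (\sum_k q k * b k))) <=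
  \sum_k q k * (a k * ln (a k)) - (\sum_k q k * a k) * \sum_k q k * ln (a k).
Proof.
move=> q0 q1 a0 b0; set A := \sum_k q k * a k; set B := \sum_k q k * b k.
move=> A0 B0.
have ln_le (x : R) : 0 < x -> ln x <= x - 1.
  move=> x0; have := @le_ln1Dx R (x - 1); rewrite addrCA subrr addr0.
  by apply; lra.
have jensen : \sum_k q k * ln (a k) <= ln A.
  have : \sum_k q k * ln (a k) <= \sum_k (q k * (ln A - 1) + q k * a k / A).
    apply: ler_sum => k _; rewrite -mulrA -mulrDr ler_wpM2l//.
    have := ln_le _ (divr_gt0 (a0 k) A0).
    by rewrite ln_div ?posrE//; lra.
  rewrite big_split/= -!mulr_suml q1 mul1r -/A divff ?gt_eqF//; lra.
(* [ln y <= y - 1] is used at [y = b k * A / (B * a k)], the ratio of the normalized values of [b]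
   and [a]; its linear terms then sum to zero. *)
have gibbs : \sum_k q k * (a k * (ln (b k) - ln B)) <=
    \sum_k (q k * (a k * ln (a k)) - q k * a k * ln A +
            (q k * b k * (A / B) - q k * a k)).
  apply: ler_sum => k _.
  have := ln_le _ (divr_gt0 (mulr_gt0 (b0 k) A0) (mulr_gt0 B0 (a0 k))).
  rewrite ln_div ?posrE ?mulr_gt0// !lnM ?posrE// => h.
  have h' : a k * (ln (b k) - ln B) <= a k * ln (a k) - a k * ln A + (b k * (A / B) - a k).
    have -> : b k * (A / B) = a k * (b k * A / (B * a k)).
      by field; rewrite !gt_eqF.
    by have := ler_wpM2l (ltW (a0 k)) h; lra.
  by have := ler_wpM2l (q0 k) h'; lra.
apply: le_trans gibbs _.
rewrite !big_split/= !sumrN -!mulr_suml -/A -/B mulrCA divff ?gt_eqF// mulr1.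
by rewrite subrr addr0 lerD2l lerN2 ler_wpM2l// ltW.
Qed.

End ExponentialBounds.

(** * Entropy on finite product spaces *)

Section FiniteProduct.
Context {R : realType} {I K : finType} (p : I -> K -> R).
Hypothesis p0 : forall i k, 0 <= p i k.
Hypothesis p1 : forall i, \sum_k p i k = 1.

Notation state := {ffun I -> K}.
Implicit Types (x y : state) (f g : state -> R).

Definition weight x : R := \prod_i p i (x i).
Definition mean f : R := \sum_x weight x * f x.
Definition update x i k : state := [ffun j => if j == i then k else x j].
Definition average i f x : R := \sum_k p i k * f (update x i k).

Lemma weight_ge0 x : 0 <= weight x. Proof. exact: prodr_ge0. Qed.

Lemma sum_weight : \sum_x weight x = 1.
Proof.
rewrite -(bigA_distr_bigA (fun i k => p i k)) /=.
by rewrite (eq_bigr (fun=> 1)) ?big1.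
Qed.

Lemma mean_cst c : mean (fun=> c) = c.
Proof. by rewrite /mean -mulr_suml sum_weight mul1r. Qed.

Lemma eq_mean f g : f =1 g -> mean f = mean g.
Proof. by move=> fg; apply: eq_bigr => x _; rewrite fg. Qed.

Lemma le_mean f g : (forall x, f x <= g x) -> mean f <= mean g.
Proof. by move=> fg; apply: ler_sum => x _; rewrite ler_wpM2l ?weight_ge0. Qed.

Lemma meanD f g : mean (fun x => f x + g x) = mean f + mean g.
Proof. by rewrite /mean -big_split; apply: eq_bigr => x _; rewrite mulrDr. Qed.

Lemma meanZ c f : mean (fun x => c * f x) = c * mean f.
Proof. by rewrite /mean mulr_sumr; apply: eq_bigr => x _; rewrite mulrCA. Qed.

Lemma meanB f g : mean (fun x => f x - g x) = mean f - mean g.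
Proof.
have -> : - mean g = mean (fun x => -1 * g x) by rewrite meanZ mulN1r.
by rewrite -meanD; apply: eq_mean => x; rewrite mulN1r.
Qed.

Lemma sum_weighted_gt0 i (b : K -> R) : (forall k, 0 < b k) -> 0 < \sum_k p i k * b k.
Proof.
move=> b0; have h k : 0 <= p i k * b k by rewrite mulr_ge0// ltW.
rewrite lt_neqAle sumr_ge0// andbT eq_sym psumr_neq0//.
have : \sum_k p i k != 0 by rewrite p1 oner_eq0.
rewrite psumr_neq0// => /hasP[k kK pk]; apply/hasP; exists k => //=.
by rewrite /= mulr_gt0.
Qed.

Lemma mean_gt0 f : (forall x, 0 < f x) -> 0 < mean f.
Proof.
move=> f0; have h x : 0 <= weight x * f x by rewrite mulr_ge0 ?weight_ge0// ltW.
rewrite lt_neqAle sumr_ge0// andbT eq_sym psumr_neq0//.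
have : \sum_x weight x != 0 by rewrite sum_weight oner_eq0.
rewrite psumr_neq0; last by move=> *; exact: weight_ge0.
move=> /hasP[x xX px]; apply/hasP; exists x => //=; by rewrite mulr_gt0.
Qed.

Lemma update_id x i : update x i (x i) = x.
Proof. by apply/ffunP => j; rewrite ffunE; case: eqP => // ->. Qed.

Lemma update_same x i k : update x i k i = k.
Proof. by rewrite ffunE eqxx. Qed.

Lemma update_update x i k l : update (update x i k) i l = update x i l.
Proof. by apply/ffunP => j; rewrite !ffunE; case: eqP. Qed.

Lemma average_update i f x k : average i f (update x i k) = average i f x.
Proof. by apply: eq_bigr => l _; rewrite update_update. Qed.

Lemma average_gt0 i f : (forall x, 0 < f x) -> forall x, 0 < average i f x.
Proof. by move=> f0 x; apply: sum_weighted_gt0. Qed.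

(* Resampling coordinate [i] yields an exchangeable pair. *)
Lemma mean_exchange i (Phi : state -> state -> R) :
  mean (fun x => \sum_k p i k * Phi x (update x i k)) =
  mean (fun x => \sum_k p i k * Phi (update x i k) x).
Proof.
rewrite /mean.
under eq_bigr do rewrite mulr_sumr.
under [RHS]eq_bigr do rewrite mulr_sumr.
rewrite !pair_big/=.
(* [h] swaps the old and the new value at coordinate [i], which preserves [weight x * p i k]. *)
pose h (xk : state * K) := (update xk.1 i xk.2, xk.1 i).
have hK : involutive h.
  by move=> [x k]; rewrite /h/= update_update update_id update_same.
rewrite (reindex_inj (inv_inj hK))/=; apply: eq_bigr => -[x k] _ /=.
rewrite update_update update_id !mulrA; congr (_ * _).
rewrite /weight (bigD1 i)//= [in RHS](bigD1 i)//= update_same.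
rewrite (eq_bigr (fun j => p j (x j))); first by ring.
by move=> j ji; rewrite ffunE (negbTE ji).
Qed.

Lemma mean_average i f : mean (average i f) = mean f.
Proof.
rewrite /average (mean_exchange i (fun _ y => f y)); apply: eq_mean => x.
by rewrite -mulr_suml p1 mul1r.
Qed.

(** [average i] is the conditional expectation given the coordinates other than [i]: [average i g]
    is constant along coordinate [i] and factors out. *)
Lemma mean_mul_average i f g :
  mean (fun x => f x * average i g x) = mean (fun x => average i f x * average i g x).
Proof.
rewrite -[LHS](mean_average i); apply: eq_mean => x.
rewrite {1}/average mulr_suml; apply: eq_bigr => k _.
by rewrite average_update mulrA.
Qed.

(** On each line parallel to coordinate [i] this is the covariance inequality with [q = p i]. *)
Lemma mean_log_gain i f g : (forall x, 0 < f x) -> (forall x, 0 < g x) ->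
  mean (fun x => f x * (ln (g x) - ln (average i g x))) <=
  mean (fun x => f x * (ln (f x) - average i (fun y => ln (f y)) x)).
Proof.
move=> f0 g0; under [leRHS]eq_mean do rewrite mulrBr.
rewrite meanB mean_mul_average -[leLHS](mean_average i).
rewrite -(mean_average i (fun x => f x * ln (f x))) -meanB.
apply: le_mean => x; rewrite [leLHS]/average.
under eq_bigr do rewrite average_update.
by apply: covariance_ge_log_gain => //; exact: sum_weighted_gt0.
Qed.

(** Integrates out the coordinates of [s] one at a time, interpolating between [f] and its mean. *)
Definition averages (s : seq I) f := foldr average f s.

Lemma averages_gt0 s f : (forall x, 0 < f x) -> forall x, 0 < averages s f x.
Proof. by move=> f0; elim: s => [|i s IH]//= x; exact: average_gt0. Qed.

Lemma mean_averages s f : mean (averages s f) = mean f.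
Proof. by elim: s => //= i s <-; rewrite mean_average. Qed.

Lemma averages_local s f x y :
  (forall i, i \notin s -> x i = y i) -> averages s f x = averages s f y.
Proof.
elim: s x y => [|i s IH] x y xy /=; first by congr f; apply/ffunP => i; apply: xy.
apply: eq_bigr => k _; congr (_ * _); apply: IH => j js.
by rewrite !ffunE; case: eqP => // /eqP ji; apply: xy; rewrite inE negb_or ji.
Qed.

Lemma averages_enum f x : averages (enum I) f x = mean f.
Proof.
rewrite -(mean_averages (enum I)) -[LHS](mean_cst); apply: eq_mean => y.
by apply: averages_local => i; rewrite mem_enum.
Qed.

Definition entropy f : R := mean (fun x => f x * ln (f x)) - mean f * ln (mean f).

(** [ln f - ln (mean f)] telescopes as the coordinates are integrated out. Each increment is a log
    gain with [g = averages s f], and its bound by the covariance of [f] and [ln f] no longer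
    involves [s]. *)
Lemma entropy_tensorization f : (forall x, 0 < f x) ->
  entropy f <= \sum_i mean (fun x => f x * (ln (f x) - average i (fun y => ln (f y)) x)).
Proof.
move=> f0.
suff tele s : mean (fun x => f x * (ln (f x) - ln (averages s f x))) <=
    \sum_(i <- s) mean (fun x => f x * (ln (f x) - average i (fun y => ln (f y)) x)).
  rewrite -big_enum; apply: le_trans (tele (enum I)).
  under [leRHS]eq_mean do rewrite averages_enum mulrBr (mulrC _ (ln (mean f))).
  by rewrite meanB meanZ (mulrC (ln _)).
elim: s => [|i s IH].
  by under eq_mean do rewrite subrr mulr0; rewrite mean_cst big_nil.
have -> : mean (fun x => f x * (ln (f x) - ln (averages (i :: s) f x))) =
    mean (fun x => f x * (ln (averages s f x) - ln (average i (averages s f) x))) +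
    mean (fun x => f x * (ln (f x) - ln (averages s f x))).
  by rewrite -meanD; apply: eq_mean => x /=; ring.
rewrite big_cons lerD//; apply: mean_log_gain => //; exact: averages_gt0.
Qed.

(** The covariance is the mean of [f x] times the increment of [g] under resampling; adding the same
    expression for the exchanged pair symmetrizes it. *)
Lemma twice_mean_covariance i f g :
  2 * mean (fun x => f x * (g x - average i g x)) =
  mean (fun x => \sum_k p i k * ((f x - f (update x i k)) * (g x - g (update x i k)))).
Proof.
have -> : mean (fun x => f x * (g x - average i g x)) =
    mean (fun x => \sum_k p i k * (f x * (g x - g (update x i k)))).
  apply: eq_mean => x.
  transitivity (\sum_k p i k * (f x * g x) - \sum_k f x * (p i k * g (update x i k))).
    by rewrite -mulr_suml p1 mul1r -mulr_sumr mulrBr.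
  by rewrite -sumrB; apply: eq_bigr => k _; ring.
rewrite mulr_natl mulr2n.
rewrite {2}(mean_exchange i (fun x y => f x * (g x - g y))) -meanD.
apply: eq_mean => x; rewrite -big_split; apply: eq_bigr => k _ /=; ring.
Qed.

End FiniteProduct.

(** * Finite passage times *)

Section FinitePassageTime.
Context {R : realType} {I K : finType} (p : I -> K -> R).
Hypothesis p0 : forall i k, 0 <= p i k.
Hypothesis p1 : forall i, \sum_k p i k = 1.
Variable v : K -> R.
Hypothesis v0 : forall k, 0 <= v k.
Hypothesis exp_moment : forall i, \sum_k p i k * expR (v k) <= 2.
Variables (Z : {ffun I -> K} -> R) (opt : {ffun I -> K} -> {set I}) (r : R).
Hypothesis ZE : forall x, Z x = \sum_(i in opt x) v (x i).
Hypothesis Z_le : forall x y, Z x <= \sum_(i in opt y) v (x i).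
Hypothesis opt_card : forall x, #|opt x|%:R <= r.

Local Notation E := (mean p).
Local Notation mgf l := (E (fun x => expR (l * Z x))).

(** The set optimal for [x] still competes after the update, and its sum changes only through
    coordinate [i]. *)
Lemma passage_update x i k :
  Z (update x i k) - Z x <= if i \in opt x then v k else 0.
Proof.
have [iS|iS] := boolP (i \in opt x).
  have := Z_le (update x i k) x; rewrite (ZE x) !(bigD1 (P := mem (opt x)) i iS)/=.
  rewrite update_same (eq_bigr (fun j => v (x j))).
    by have := v0 (x i); lra.
  by move=> j /andP[_ ji]; rewrite ffunE (negbTE ji).
rewrite subr_le0 (ZE x); apply: le_trans (Z_le _ x) _.
rewrite le_eqVlt; apply/orP; left; apply/eqP; apply: eq_bigr => j jS.
by rewrite ffunE; case: eqP => // ji; rewrite -ji jS in iS.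
Qed.

(* Only one of the two terms on the right is needed: that of the configuration with the smaller passage time. *)
Lemma covariance_passage_le l x i k : `|l| <= 2^-1 ->
  (expR (l * Z x) - expR (l * Z (update x i k))) * (l * Z x - l * Z (update x i k)) <=
  8 * l ^+ 2 * ((i \in opt x)%:R * expR (l * Z x) * expR (v k) +
   (i \in opt (update x i k))%:R * expR (l * Z (update x i k)) * expR (v (x i))).
Proof.
move=> l2.
have key y j : Z y <= Z (update y i j) ->
    (expR (l * Z y) - expR (l * Z (update y i j))) * (l * Z y - l * Z (update y i j)) <=
    8 * l ^+ 2 * ((i \in opt y)%:R * expR (l * Z y) * expR (v j)).
  move=> yZ; have := passage_update y i j; set y' := update y i j in yZ *.
  case: ifP => iS yy'; last first.
    by rewrite (_ : Z y' = Z y) ?subrr ?mul0r ?mulr0//; apply/eqP; rewrite eq_le yZ; lra.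
  have t0 : 0 <= Z y' - Z y by lra.
  have := mulr_expR_sub1_le t0 yy' l2.
  move=> /(ler_wpM2l (expR_ge0 (l * Z y))).
  have -> : expR (l * Z y') = expR (l * Z y) * expR (l * (Z y' - Z y)).
    by rewrite -expRD; congr expR; ring.
  rewrite mul1r; lra.
have nn (b : bool) (s t : R) : 0 <= 8 * l ^+ 2 * (b%:R * expR s * expR t).
  by rewrite !(sqr_ge0, expR_ge0, ler0n, mulr_ge0).
rewrite [leRHS]mulrDr; have [yZ|yZ] := leP (Z x) (Z (update x i k)).
  by rewrite (le_trans (key _ _ yZ))// lerDl nn.
(* In the opposite order the roles are exchanged: resampling [update x i k] at [i] with the value
   [x i] restores [x]. *)
have := key (update x i k) (x i); rewrite update_update update_id => /(_ (ltW yZ)).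
move=> h; apply: (@le_trans _ _ (8 * l ^+ 2 * ((i \in opt (update x i k))%:R *
  expR (l * Z (update x i k)) * expR (v (x i))))); last by rewrite lerDr nn.
by apply: le_trans h; rewrite le_eqVlt; apply/orP; left; apply/eqP; ring.
Qed.

Lemma mgf_gt0 l : 0 < mgf l.
Proof. by apply: mean_gt0 => // x; exact: expR_gt0. Qed.

(** By exchangeability the two terms of the covariance bound have equal means, which cancels the
    factor 2 of the symmetrization. The exponential moment turns 8 into 16, and the indicators of
    [opt x] sum to at most [r]. *)
Lemma entropy_passage_le l : `|l| <= 2^-1 ->
  entropy p (fun x => expR (l * Z x)) <= 16 * r * l ^+ 2 * mgf l.
Proof.
move=> l2; apply: le_trans (entropy_tensorization p0 p1 _) _.
  by move=> x; exact: expR_gt0.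
have site i : mean p (fun x => expR (l * Z x) *
      (ln (expR (l * Z x)) - average p i (fun y => ln (expR (l * Z y))) x)) <=
    16 * l ^+ 2 * mean p (fun x => (i \in opt x)%:R * expR (l * Z x)).
  rewrite -(ler_pM2l (ltr0n R 2)) twice_mean_covariance//.
  pose Phi (x y : {ffun I -> K}) := 8 * l ^+ 2 * ((i \in opt x)%:R * expR (l * Z x) * expR (v (y i))).
  apply: (@le_trans _ _ (mean p (fun x => \sum_k p i k * Phi x (update x i k)) +
      mean p (fun x => \sum_k p i k * Phi (update x i k) x))).
    rewrite -meanD; apply: le_mean => // x; rewrite -big_split/=.
    apply: ler_sum => k _; rewrite -mulrDr ler_wpM2l// !expRK /Phi update_same -mulrDr.
    exact: covariance_passage_le.
  rewrite -mean_exchange// -mulr2n -[leLHS]mulr_natl ler_pM2l ?ltr0n// -meanZ.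
  apply: le_mean => // x; rewrite /Phi.
  under eq_bigr do rewrite update_same.
  set c := (i \in opt x)%:R * _.
  have c0 : 0 <= c by rewrite mulr_ge0 ?ler0n ?expR_ge0.
  apply: (@le_trans _ _ (8 * l ^+ 2 * c * \sum_k p i k * expR (v k))).
    by rewrite mulr_sumr; apply: ler_sum => k _; lra.
  have : 8 * l ^+ 2 * c * (\sum_k p i k * expR (v k)) <= 8 * l ^+ 2 * c * 2.
    by rewrite ler_wpM2l// !(sqr_ge0, mulr_ge0).
  lra.
apply: (le_trans (ler_sum _ (fun i _ => site i))).
rewrite -mulr_sumr (_ : 16 * r * l ^+ 2 * _ = 16 * l ^+ 2 * (r * mgf l)); last by ring.
rewrite ler_wpM2l ?(sqr_ge0, mulr_ge0)//.
rewrite -meanZ /mean exchange_big/=; apply: ler_sum => x _.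
rewrite -mulr_sumr ler_wpM2l ?weight_ge0// -mulr_suml ler_wpM2r ?expR_ge0//.
by apply: le_trans (opt_card x); rewrite -natr_sum ler_nat -sum1_card [leqRHS]big_mkcond.
Qed.

(* Gibbs' principle with the tilted law [expR (l * Z) / mgf l] as trial measure for [mgf (l / 2)]. *)
Lemma ln_mgf_halve l : `|l| <= 2^-1 ->
  ln (mgf l) <= 2 * ln (mgf (l / 2)) + 16 * r * l ^+ 2.
Proof.
move=> l2; have H0 := mgf_gt0 l; have := entropy_passage_le l2.
rewrite /entropy; under eq_mean do rewrite expRK.
set m := mean p (fun x => expR (l * Z x) * (l * Z x)) => ent.
(* [m / mgf l] is the tilted mean of [l * Z], so [c] is that of [- (l * Z) / 2], the exponent
   leading from [expR (l * Z)] to [expR (l / 2 * Z)]. The tangent of [expR] at [c] then yields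
   Jensen's inequality. *)
pose c := - (m / mgf l) / 2.
have half : expR c * mgf l <= mgf (l / 2).
  have -> : expR c * mgf l =
      mean p (fun x => expR c * (expR (l * Z x) * (1 + (- (l * Z x) / 2 - c)))).
    rewrite meanZ; congr (_ * _).
    have -> : mean p (fun x => expR (l * Z x) * (1 + (- (l * Z x) / 2 - c))) =
        mean p (fun x => (1 - c) * expR (l * Z x) - 2^-1 * (expR (l * Z x) * (l * Z x))).
      by apply: eq_mean => x; field.
    by rewrite meanB !meanZ -/m /c; field; rewrite gt_eqF.
  apply: le_mean => // x.
  have -> : expR (l / 2 * Z x) = expR c * (expR (l * Z x) * expR (- (l * Z x) / 2 - c)).
    by rewrite -!expRD; congr expR; field.
  by rewrite !ler_wpM2l ?expR_ge0// expR_ge1Dx.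
have lnhalf : c + ln (mgf l) <= ln (mgf (l / 2)).
  rewrite -[c in c + _]expRK -lnM ?posrE ?expR_gt0//.
  by rewrite ler_ln ?posrE ?mulr_gt0 ?expR_gt0 ?mgf_gt0.
have : m / mgf l <= ln (mgf l) + 16 * r * l ^+ 2 by rewrite ler_pdivrMr//; lra.
rewrite /c in lnhalf; lra.
Qed.

(** Halving [l] divides [l ^+ 2] by 4 while the prefactor doubles, so the errors form a geometric
    series: [16 * (1 + 1/2 + 1/4 + ...) = 32]. *)
Lemma ln_mgf_iter n l : `|l| <= 2^-1 ->
  ln (mgf l) <= 2 ^+ n * ln (mgf (l / 2 ^+ n)) + 32 * r * l ^+ 2.
Proof.
(* A state exists because the weights sum to 1; its optimal set shows [0 <= r]. *)
have [x _|noS] := pickP (@predT {ffun I -> K}); last first.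
  by have := sum_weight p1; rewrite big_pred0// => /eqP; rewrite eq_sym oner_eq0.
have r0 : 0 <= r by apply: le_trans (opt_card x); rewrite ler0n.
elim: n l => [|n IH] l l2.
  by rewrite expr0 mul1r divr1 lerDl !(sqr_ge0, mulr_ge0).
have l4 : `|l / 2| <= 2^-1.
  by rewrite normrM normfV (ger0_norm (ler0n R 2)); have := normr_ge0 l; lra.
apply: le_trans (ln_mgf_halve l2) _.
have := IH _ l4; rewrite -mulrA -invfM -exprS exprMn exprVn.
rewrite (_ : 2 ^+ n.+1 * _ = 2 * (2 ^+ n * ln (mgf (l / 2 ^+ n.+1)))); last first.
  by rewrite exprS mulrA.
lra.
Qed.

(** As [n] grows, [2 ^+ n * ln (mgf (l / 2 ^+ n))] tends to [l * E Z]: on a finite space [Z] is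
    bounded, so the second-order error is at most [C / 2 ^+ n]. *)
Lemma mgf_le l : `|l| <= 2^-1 -> mgf l <= expR (l * E Z + 32 * r * l ^+ 2).
Proof.
move=> l2; rewrite -[leLHS]lnK ?posrE ?mgf_gt0// ler_expR.
pose B := \sum_x Z x.
have Z0 x : 0 <= Z x by rewrite ZE sumr_ge0.
have ZB x : Z x <= B by rewrite /B (bigD1 x)//= lerDl sumr_ge0.
pose C := l ^+ 2 * B ^+ 2 * expR (`|l| * B).
have step n : ln (mgf l) <= l * E Z + 32 * r * l ^+ 2 + C / 2 ^+ n.
  apply: le_trans (ln_mgf_iter n l2) _; rewrite addrAC lerD2r.
  set e := l / 2 ^+ n.
  have n0 : 0 < 2 ^+ n :> R by rewrite exprn_gt0.
  have el : `|e| <= `|l|.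
    rewrite normrM normfV (gtr0_norm n0) ler_piMr// invf_le1//.
    by rewrite exprn_ege1// ler1n.
  have : mgf e <= 1 + e * E Z + e ^+ 2 * B ^+ 2 * expR (`|l| * B).
    apply: (@le_trans _ _ (E (fun x => 1 + e * Z x + e ^+ 2 * B ^+ 2 * expR (`|l| * B)))).
      apply: le_mean => // x; apply: (le_trans (expR_le_quadratic _)).
      rewrite lerD2l exprMn; apply: ler_pM.
      - by rewrite mulr_ge0 ?sqr_ge0.
      - exact: expR_ge0.
      - by rewrite ler_wpM2l ?sqr_ge0// lerXn2r ?nnegrE ?sumr_ge0.
      - by rewrite ler_expR normrM (ger0_norm (Z0 _)) ler_pM.
    by rewrite !meanD meanZ !mean_cst.
  have : ln (mgf e) <= mgf e - 1.
    rewrite -[X in ln X](subrK 1) addrC le_ln1Dx//.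
    by have := mgf_gt0 e; lra.
  move=> h1 h2; have /(ler_wpM2l (ltW n0)) := le_trans h1 (lerB h2 (lexx 1)).
  move/le_trans; apply; rewrite le_eqVlt; apply/orP; left; apply/eqP.
  by rewrite /C /e; field; rewrite gt_eqF.
apply/ler_addgt0Pr => e e0.
have C0 : 0 <= C by rewrite !(sqr_ge0, expR_ge0, mulr_ge0).
pose n := Num.trunc (C / e).
apply: le_trans (step n.+1) _; rewrite lerD2l ler_pdivrMr ?exprn_gt0//.
have : C / e < n.+1%:R by rewrite truncnS_gt.
have : n.+1%:R <= 2 ^+ n.+1 :> R by rewrite -natrX ler_nat ltnW// ltn_expl.
rewrite -ler_pdivrMl// (mulrC _ C) => h1 h2; exact: le_trans (ltW h2) h1.
Qed.

Definition mass (A : pred {ffun I -> K}) : R := \sum_(x | A x) weight p x.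

Lemma mass_le (A : pred {ffun I -> K}) f : (forall x, 0 <= f x) ->
  (forall x, A x -> 1 <= f x) -> mass A <= E f.
Proof.
move=> f0 Af; rewrite /mass /mean [leLHS]big_mkcond/=; apply: ler_sum => x _.
case: ifPn => Ax; last by rewrite mulr_ge0 ?weight_ge0.
by rewrite ler_peMr ?weight_ge0 ?Af.
Qed.

(** Markov's inequality at [- l] and at [l] produces the factors [expR (- l * E Z)] and
    [expR (l * E Z)], which cancel in the product. *)
Lemma finite_two_sided a b l : 0 <= l <= 2^-1 ->
  mass [pred x | Z x <= a] * mass [pred x | b <= Z x] <=
  expR (64 * r * l ^+ 2 - l * (b - a)).
Proof.
move=> /andP[l0 l2].
have lower : mass [pred x | Z x <= a] <= expR (l * a) * mgf (- l).
  rewrite -meanZ; apply: mass_le => [x|x /= Zx]; first by rewrite mulr_ge0 ?expR_ge0.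
  rewrite -expRD -[leLHS]expR0 ler_expR.
  by have := ler_wpM2l l0 Zx; lra.
have upper : mass [pred x | b <= Z x] <= expR (- (l * b)) * mgf l.
  rewrite -meanZ; apply: mass_le => [x|x /= Zx]; first by rewrite mulr_ge0 ?expR_ge0.
  rewrite -expRD -[leLHS]expR0 ler_expR.
  by have := ler_wpM2l l0 Zx; lra.
have mass0 A : 0 <= mass A by apply: sumr_ge0 => *; exact: weight_ge0.
have nl : `|l| <= 2^-1 by rewrite ger0_norm.
have nl' : `|- l| <= 2^-1 by rewrite normrN.
apply: (@le_trans _ _ ((expR (l * a) * expR (- l * E Z + 32 * r * (- l) ^+ 2)) *
   (expR (- (l * b)) * expR (l * E Z + 32 * r * l ^+ 2)))).
  apply: ler_pM => //.
    by apply: le_trans lower _; rewrite ler_wpM2l ?expR_ge0// mgf_le.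
  by apply: le_trans upper _; rewrite ler_wpM2l ?expR_ge0// mgf_le.
rewrite -!expRD ler_expR le_eqVlt; apply/orP; left; apply/eqP; ring.
Qed.

End FinitePassageTime.

(** * Discretization *)

Section ProbabilityFacts.
Context {d : measure_display} {T : measurableType d} {R : realType}.
Variable P : probability T R.

Lemma fine_probability_le (A B : set T) : measurable A -> measurable B ->
  A `<=` B -> fine (P A) <= fine (P B).
Proof.
by move=> mA mB AB; rewrite fine_le ?fin_num_measure// le_measure ?inE.
Qed.

Lemma fine_probability_ge0 (A : set T) : 0 <= fine (P A).
Proof. exact/fine_ge0/measure_ge0. Qed.

Lemma fine_probability_le1 (A : set T) : measurable A -> fine (P A) <= 1.
Proof. by move=> mA; rewrite -lee_fin fineK ?fin_num_measure ?probability_le1. Qed.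

Lemma fine_probability_union (I : finType) (S : pred I) (B : set T) (A : I -> set T) :
  measurable B -> (forall i, measurable (A i)) ->
  (forall w, B w -> exists2 i, S i & A i w) ->
  fine (P B) <= \sum_(i | S i) fine (P (A i)).
Proof.
move=> mB mA BA.
have mU (s : seq I) : measurable (\big[setU/set0]_(i <- s | S i) A i).
  by apply: bigsetU_measurable.
have sub (s : seq I) :
    fine (P (\big[setU/set0]_(i <- s | S i) A i)) <= \sum_(i <- s | S i) fine (P (A i)).
  elim: s => [|i s IH]; first by rewrite !big_nil measure0.
  rewrite !big_cons; case: ifP => // Si.
  apply: le_trans (lerD (lexx _) IH).
  rewrite -fineD ?fin_num_measure// fine_le ?fin_numD ?fin_num_measure//=.
    exact: measurableU.
  by apply: measureU2.
apply: le_trans (sub _); apply: fine_probability_le => // w /BA[i Si Aiw].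
by rewrite -bigcup_seq_cond; exists i => //=; rewrite mem_index_enum.
Qed.

End ProbabilityFacts.

Section Discretization.
Context {d : measure_display} {T : measurableType d} {R : realType}.
Variables (P : probability T R) (I : finType) (X : I -> {RV P >-> R}).
Hypothesis X0 : forall i w, 0 <= X i w.
Hypothesis indep : forall B : I -> set R, (forall i, measurable (B i)) ->
  P [set w | forall i, B i (X i w)] = (\prod_i P (X i @^-1` B i))%E.
Hypothesis exp_moment : forall i, (\int[P]_w (expR (X i w))%:E <= 2%:E)%E.
Variables (delta : R) (N : nat).
Hypothesis delta_gt0 : 0 < delta.

(* The last cell collects all [x >= N * delta]. *)
Definition cell (x : R) : 'I_N.+1 := inord (minn (Num.trunc (x / delta)) N).

Lemma cell_val x : cell x = minn (Num.trunc (x / delta)) N :> nat.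
Proof. by rewrite inordK// ltnS geq_minr. Qed.

Definition level (k : 'I_N.+1) : R := k%:R * delta.

Lemma level_ge0 k : 0 <= level k.
Proof. by rewrite mulr_ge0// ltW. Qed.

Lemma level_cell_le x : 0 <= x -> level (cell x) <= x.
Proof.
move=> x0; rewrite /level -ler_pdivlMr// cell_val.
apply: (@le_trans _ _ (Num.trunc (x / delta))%:R); first by rewrite ler_nat geq_minl.
by rewrite truncn_le divr_ge0// ltW.
Qed.

Lemma le_level_cell x : cell x != ord_max -> x <= level (cell x) + delta.
Proof.
rewrite -(inj_eq val_inj)/= cell_val => h.
have tN : (Num.trunc (x / delta) <= N)%N.
  by apply: contraNT h; rewrite -ltnNge => /ltnW/minn_idPr ->.
rewrite /level cell_val (minn_idPl tN) -[X in _ + X]mul1r -mulrDl natr1.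
by rewrite -ler_pdivrMr// ltW// truncnS_gt.
Qed.

Lemma measurable_cell k : measurable (cell @^-1` [set k]).
Proof.
have mc : measurable_fun setT (fun x : R => (cell x : nat)%:R : R).
  apply: nondecreasing_measurable => // x y xy.
  rewrite ler_nat !cell_val leq_min geq_minr andbT.
  by rewrite (leq_trans (geq_minl _ _))// le_truncn// ler_pM2r ?invr_gt0.
rewrite (_ : _ @^-1` _ = (fun x : R => (cell x : nat)%:R : R) @^-1` [set (k : nat)%:R]).
  by rewrite -[X in measurable X]setTI; apply: mc.
apply/seteqP; split => x /=; first by move=> ->.
by move=> /eqP; rewrite eqr_nat => /eqP /val_inj.
Qed.

Lemma measurable_comp_cell i k : measurable (X i @^-1` (cell @^-1` [set k])).
Proof. by rewrite -[X in measurable X]setTI; apply: measurable_funP => //; exact: measurable_cell. Qed.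

Definition cell_prob i k : R := fine (P (X i @^-1` (cell @^-1` [set k]))).

Lemma sum_cell_prob i (c : 'I_N.+1 -> R) : (forall k, 0 <= c k) ->
  (\sum_k cell_prob i k * c k)%:E = (\int[P]_w (c (cell (X i w)))%:E)%E.
Proof.
move=> c0; pose A k := X i @^-1` (cell @^-1` [set k]).
have mA k : measurable (A k) := measurable_comp_cell i k.
transitivity (\int[P]_w \sum_k (c k)%:E * (\1_(A k) w)%:E)%E; last first.
  apply: eq_integral => w _; rewrite (bigD1 (cell (X i w)))//= indicE mem_set//.
  rewrite mule1 big1 ?adde0// => k kX; rewrite indicE memNset ?mule0//.
  by move=> Xk; rewrite /A/= in Xk; rewrite Xk eqxx in kX.
rewrite ge0_integral_sum//=.
- rewrite -sumEFin; apply: eq_bigr => k _.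
  rewrite ge0_integralZl_EFin//.
  + by rewrite integral_indic// setIT -[X in (_ * X)%E]fineK ?fin_num_measure// -EFinM mulrC.
  + by apply/measurable_EFinP.
- by move=> k; apply: emeasurable_funM => //; apply/measurable_EFinP.
- by move=> k w _; rewrite mule_ge0 ?lee_fin.
Qed.

Lemma cell_prob_ge0 i k : 0 <= cell_prob i k.
Proof. exact: fine_probability_ge0. Qed.

Lemma cell_prob_sum1 i : \sum_k cell_prob i k = 1.
Proof.
have := @sum_cell_prob i (fun=> 1) (fun=> ler01); rewrite integral_cst// => h.
under eq_bigr do rewrite -[cell_prob _ _]mulr1.
exact/EFin_inj/(etrans h)/(etrans (mul1e _))/probability_setT.
Qed.

(** Rounding down keeps the level below the variable, even in the last cell, so the moment bound
    survives. *)
Lemma cell_prob_exp_moment i : \sum_k cell_prob i k * expR (level k) <= 2.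
Proof.
rewrite -lee_fin sum_cell_prob; last by move=> k; exact: expR_ge0.
apply: le_trans (exp_moment i); apply: ge0_le_integral => //.
- have mf : measurable_fun setT (fun x : R => expR (level (cell x))).
    apply: nondecreasing_measurable => // x y xy.
    rewrite ler_expR ler_pM2r// ler_nat !cell_val leq_min geq_minr andbT.
    by rewrite (leq_trans (geq_minl _ _))// le_truncn// ler_pM2r ?invr_gt0.
  by apply/measurable_EFinP; apply: (measurableT_comp mf).
- by apply/measurable_EFinP; apply: measurableT_comp.
- by move=> w _; rewrite lee_fin ler_expR level_cell_le.
Qed.

(** The events prescribing all cells by some [y] in [S] cover [B]; by independence each has
    probability [weight y]. *)
Lemma event_le_mass (B : set T) (S : pred {ffun I -> 'I_N.+1}) : measurable B ->
  (forall w, B w -> S [ffun i => cell (X i w)]) -> fine (P B) <= mass cell_prob S.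
Proof.
move=> mB BS; pose C (y : {ffun I -> 'I_N.+1}) := [set w | forall i, cell (X i w) = y i].
have mC y : measurable (C y).
  rewrite (_ : C y = \bigcap_(i in [set: I]) X i @^-1` (cell @^-1` [set y i])).
    apply: fin_bigcap_measurable => // i _; exact: measurable_comp_cell.
  by apply/seteqP; split => [w h i _|w h i]; [exact: h|apply: (h i)].
apply: le_trans (fine_probability_union P (S := S) (A := C) mB mC _) _.
  move=> w /BS Sw; exists [ffun i => cell (X i w)] => //.
  by move=> i; rewrite ffunE.
rewrite /mass (eq_bigr (weight cell_prob))// => y _; apply: EFin_inj.
rewrite fineK ?fin_num_measure// (indep (B := fun i => cell @^-1` [set y i])).
  rewrite /weight -prodEFin; apply: eq_bigr => i _.
  by rewrite fineK// fin_num_measure//; exact: measurable_comp_cell.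
by move=> i; exact: measurable_cell.
Qed.

End Discretization.

Lemma le_expR_addgt0 {R : realType} (x c : R) :
  (forall e, 0 < e -> x <= expR (c + e)) -> x <= expR c.
Proof.
move=> xc; rewrite leNgt; apply/negP => cx.
have x0 : 0 < x := lt_trans (expR_gt0 c) cx.
have : c < ln x by rewrite -ltr_expR lnK.
move=> cln; have /xc : 0 < (ln x - c) / 2 by lra.
by apply/negP; rewrite -ltNge -[ltRHS]lnK// ltr_expR; lra.
Qed.

(** * Finite families of finite sets on a general probability space *)

Section FiniteFamily.
Context {d : measure_display} {T : measurableType d} {R : realType}.
Variables (P : probability T R) (I : finType) (X : I -> {RV P >-> R}).
Hypothesis X0 : forall i w, 0 <= X i w.
Hypothesis indep : forall B : I -> set R, (forall i, measurable (B i)) ->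
  P [set w | forall i, B i (X i w)] = (\prod_i P (X i @^-1` B i))%E.
Hypothesis exp_moment : forall i, (\int[P]_w (expR (X i w))%:E <= 2%:E)%E.
Variables (n : nat) (A : 'I_n.+1 -> {set I}) (r : R).
Hypothesis card_A : forall m, #|A m|%:R <= r.

Let low (a : R) := [set w | exists m, \sum_(i in A m) X i w <= a].
Let high (b : R) := [set w | forall m, b <= \sum_(i in A m) X i w].

Lemma measurable_sum_finset (B : {set I}) : measurable_fun setT (fun w => \sum_(i in B) X i w).
Proof.
by under eq_fun do rewrite -big_enum; apply: measurable_sum.
Qed.

Lemma measurable_low a : measurable (low a).
Proof.
rewrite (_ : low a = \bigcup_(m in [set: 'I_n.+1])
    (fun w => \sum_(i in A m) X i w) @^-1` `]-oo, a]).
  apply: fin_bigcup_measurable => // m _.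
  by rewrite -[X in measurable X]setTI; apply: measurable_sum_finset.
apply/seteqP; split => w /=.
  by move=> [m wm]; exists m => //=; rewrite in_itv.
by move=> [m _ /=]; rewrite in_itv/=; exists m.
Qed.

Lemma measurable_high b : measurable (high b).
Proof.
rewrite (_ : high b = \bigcap_(m in [set: 'I_n.+1])
    (fun w => \sum_(i in A m) X i w) @^-1` `[b, +oo[).
  apply: fin_bigcap_measurable => // m _.
  by rewrite -[X in measurable X]setTI; apply: measurable_sum_finset.
apply/seteqP; split => w /=.
  by move=> wm m _ /=; rewrite in_itv/= andbT.
by move=> wm m; have := wm m Logic.I; rewrite /= in_itv/= andbT.
Qed.

(** Rounding down can only enlarge the lower event. In the upper one it costs at most [delta] per
    edge, hence [r * delta], unless some variable lies in the last cell; the subtracted term bounds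
    that exception. *)
Lemma two_sided_discretized a b l delta N : 0 <= l <= 2^-1 -> 0 < delta ->
  fine (P (low a)) * (fine (P (high b)) - #|I|%:R * (2 / expR (N%:R * delta))) <=
  expR (64 * r * l ^+ 2 - l * (b - r * delta - a)).
Proof.
move=> l01 delta0; pose v := level delta (N := N); pose q := cell delta N.
pose best (y : {ffun I -> 'I_N.+1}) := [arg min_(m < ord0) (\sum_(i in A m) v (y i))]%O.
pose opt y := A (best y).
pose Z y := \sum_(i in opt y) v (y i).
have v0 k : 0 <= v k := level_ge0 delta0 k.
have Z_min y m : Z y <= \sum_(i in A m) v (y i).
  by rewrite /Z /opt /best; case: arg_minP => // m' _ /(_ m); apply.
pose p := cell_prob X delta (N := N).
have core := finite_two_sided (p := p) (@cell_prob_ge0 _ _ _ P I X delta N)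
  (@cell_prob_sum1 _ _ _ P I X delta N delta0) v0
  (@cell_prob_exp_moment _ _ _ P I X X0 exp_moment delta N delta0)
  (fun=> erefl) (fun x y => Z_min x _) (fun=> card_A _) _ _ l01.
have lowM : fine (P (low a)) <= mass p [pred y | Z y <= a].
  apply: event_le_mass => //; first exact: measurable_low.
  move=> w [m wm] /=; apply: le_trans (Z_min _ m) (le_trans _ wm).
  by apply: ler_sum => i _; rewrite ffunE level_cell_le.
pose C i := X i @^-1` (q @^-1` [set ord_max]).
have mC i : measurable (C i) by exact: measurable_comp_cell.
pose D := high b `&` ~` \bigcup_(i in [set: I]) C i.
have mUC : measurable (\bigcup_(i in [set: I]) C i) by exact: fin_bigcup_measurable.
have mD : measurable D by apply: measurableI (measurable_high b) (measurableC mUC).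
have highM : fine (P D) <= mass p [pred y | b - r * delta <= Z y].
  apply: event_le_mass => // w [wb wC] /=.
  pose y : {ffun I -> 'I_N.+1} := [ffun i => q (X i w)].
  rewrite lerBlDr; apply: le_trans (wb (best y)) _.
  apply: (@le_trans _ _ (\sum_(i in opt y) (v (q (X i w)) + delta))).
    apply: ler_sum => i _; apply: le_level_cell => //.
    by apply/eqP => qi; apply: wC; exists i.
  rewrite big_split/= sumr_const -mulr_natl lerD//.
    by rewrite le_eqVlt; apply/orP; left; apply/eqP; apply: eq_bigr => i _; rewrite ffunE.
  by apply: ler_wpM2r; [exact: ltW|exact: card_A].
have split_high : fine (P (high b)) <= fine (P D) + #|I|%:R * (2 / expR (N%:R * delta)).
  have h := @fine_probability_union _ _ _ P bool predT (high b)
    (fun c => if c then D else \bigcup_(i in [set: I]) C i) (measurable_high b).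
  apply: le_trans (h _ _) _; first by case.
    move=> w wb; have [wC|wC] := pselect ((\bigcup_(i in [set: I]) C i) w).
      by exists false.
    by exists true.
  rewrite big_bool/= lerD2l.
  apply: le_trans (@fine_probability_union _ _ _ P I predT _ C mUC mC _) _.
    by move=> w [i _ wi]; exists i.
  rewrite -sum1_card natr_sum mulr_suml; apply: ler_sum => i _.
  (* As in Markov's inequality, the term of the last cell alone is at most the whole exponential
     moment. *)
  rewrite mul1r ler_pdivlMr ?expR_gt0//.
  apply: le_trans (cell_prob_exp_moment X0 exp_moment N delta0 i).
  rewrite (bigD1 ord_max)//= lerDl sumr_ge0// => k _.
  by rewrite mulr_ge0 ?expR_ge0// cell_prob_ge0.
apply: le_trans (core a (b - r * delta)).
have pl := fine_probability_ge0 P (low a).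
apply: (@le_trans _ _ (fine (P (low a)) * mass p [pred y | b - r * delta <= Z y])).
  by rewrite ler_wpM2l//; lra.
rewrite ler_wpM2r//; apply: sumr_ge0 => y _; apply: weight_ge0; exact: cell_prob_ge0.
Qed.

Lemma two_sided_finite_family a b l : 0 <= l <= 2^-1 ->
  fine (P (low a)) * fine (P (high b)) <= expR (64 * r * l ^+ 2 - l * (b - a)).
Proof.
move=> l01; have /andP[l0 l2] := l01.
have r0 : 0 <= r := le_trans (ler0n _ _) (card_A ord0).
apply: le_expR_addgt0 => e e0.
(* This makes [l * r * delta <= e]; the added 1 keeps the denominator positive when [l * r = 0]. *)
pose delta := e / (l * r + 1).
have lr : 0 < l * r + 1 by rewrite ltr_wpDl ?mulr_ge0.
have delta0 : 0 < delta by rewrite divr_gt0.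
apply/ler_addgt0Pr => eta eta0.
(* Since [expR y >= y], this choice makes the truncation term at most [eta]. *)
pose N := (Num.trunc (#|I|%:R * 2 / (eta * delta))).+1.
apply: (@le_trans _ _ (expR (64 * r * l ^+ 2 - l * (b - r * delta - a)) +
    #|I|%:R * (2 / expR (N%:R * delta)))).
  have := two_sided_discretized a b N l01 delta0.
  set c := #|I|%:R * _.
  have c0 : 0 <= c by rewrite mulr_ge0 ?divr_ge0 ?expR_ge0.
  have := ler_wpM2r c0 (fine_probability_le1 P (measurable_low a)).
  by lra.
apply: lerD.
  rewrite ler_expR; have : l * r * delta <= e.
    by rewrite /delta mulrCA -[leRHS]mulr1 ler_wpM2l ?ltW// ltr_pdivrMr// mul1r ltrDl.
  by lra.
rewrite mulrA ler_pdivrMr ?expR_gt0//.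
have : #|I|%:R * 2 / (eta * delta) <= N%:R by rewrite ltW// truncnS_gt.
rewrite ler_pdivrMr ?(mulr_gt0 eta0 delta0)// => /le_trans; apply.
rewrite mulrCA ler_wpM2l ?ltW//.
by apply: lt_le_trans (expR_ge1Dx _); rewrite ltrDr.
Qed.

End FiniteFamily.

(** * Countable families *)

(** Indices outside the range of the injection fall back on [A0], so finite families are covered
    too. *)
Lemma countable_enumeration {T : Type} (F : set T) : F !=set0 -> countable F ->
  exists S : nat -> T, (forall n, F (S n)) /\ forall A, F A -> exists n, S n = A.
Proof.
move=> [A0 FA0] /countable_injP[f]; move=> finj.
have pre n : exists A, F A /\ ((exists2 B, F B & f B = n) -> f A = n).
  have [[B FB fB]|nB] := pselect (exists2 B, F B & f B = n).
    by exists B.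
  by exists A0; split => // /nB.
have [S SP] := choice pre; exists S; split=> [n|A FA]; first by have [] := SP n.
exists (f A); have [FS fS] := SP (f A).
by apply: finj; rewrite ?inE// fS//; exists A.
Qed.

(** Serves both for sums of variables and for cardinalities, which must pass from finite subsets of
    [I] to the finite type [J]. *)
Lemma big_fset_set_sub {R : Type} {idx : R} (op : Monoid.com_law idx)
    {I : choiceType} (J : {fset I}) (B : set I) (f : I -> R) :
  finite_set B -> B `<=` [set` J] ->
  \big[op/idx]_(j in [set j : J | `[< B (val j) >]]%SET) f (val j) =
  \big[op/idx]_(i <- fset_set B) f i.
Proof.
move=> Bfin BJ.
rewrite (eq_bigl (fun j : J => val j \in fset_set B)); last first.
  by move=> j; rewrite inE in_fset_set.
rewrite -(big_seq_fsetE op J (fun i => i \in fset_set B)) -big_filter.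
apply: perm_big; apply: uniq_perm; rewrite ?filter_uniq ?fset_uniq// => i.
rewrite mem_filter; apply: andb_idr; rewrite in_fset_set// => /set_mem Bi.
exact: BJ.
Qed.

Lemma mutually_independent_fset (d : measure_display) (T : measurableType d)
    (R : realType) (P : probability T R) (I : choiceType) (E : set I)
    (X : I -> {RV P >-> R}) (J : {fset I}) :
  mutually_independent E X -> [set` J] `<=` E ->
  forall B : J -> set R, (forall j, measurable (B j)) ->
  P [set w | forall j, B j (X (val j) w)] = (\prod_j P (X (val j) @^-1` B j))%E.
Proof.
move=> indep JE B mB.
pose C i := if insub i is Some j then B j else setT.
have CE (j : J) : C (val j) = B j by rewrite /C valK.
have -> : [set w | forall j, B j (X (val j) w)] = \bigcap_(i in [set` J]) (X i @^-1` C i).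
  apply/seteqP; split => w /= h.
    by move=> i /= iJ; have := h [` iJ]%fset; rewrite -CE.
  by move=> j; have := h (val j) (valP j); rewrite /= CE.
rewrite indep//; last by move=> i _; rewrite /C; case: insubP.
by rewrite big_seq_fsetE/=; apply: eq_bigr => j _; rewrite CE.
Qed.

Section CountableFamily.
Context {d : measure_display} {T : measurableType d} {R : realType}.
Variables (P : probability T R) (I : choiceType) (E : set I) (X : I -> {RV P >-> R}).
Hypothesis indep : mutually_independent E X.
Hypothesis X0 : forall e, E e -> forall w, 0 <= X e w.
Hypothesis exp_moment : forall e, E e -> (\int[P]_w (expR (X e w))%:E <= 2%:E)%E.
Variables (F : set (set I)) (r : R).
Hypothesis F_neq0 : F !=set0.
Hypothesis F_countable : countable F.
Hypothesis F_sub : forall A, F A -> A `<=` E.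
Hypothesis F_finite : forall A, F A -> finite_set A.
Hypothesis F_card : forall A, F A -> #|` fset_set A|%:R <= r.

Let total (A : set I) w := \sum_(e \in A) X e w.
Let Z := passage_time (fun e => X e) F.

Lemma total_ge0 A w : F A -> 0 <= total A w.
Proof. by move=> FA; apply: fsumr_ge0 => e /(F_sub FA) Ee; exact: X0. Qed.

Lemma measurable_total A : F A -> measurable_fun setT (total A).
Proof.
move=> FA; have -> : total A = (fun w => \sum_(e <- fset_set A) X e w).
  by apply/funext => w; rewrite /total fsbig_finite//; exact: F_finite.
exact: measurable_sum.
Qed.

(** Nonnegativity supplies the lower bound 0 and [F] is nonempty, so [inf] is a true infimum and not
    a default value. *)
Lemma le_passage_time b w : b <= Z w <-> forall A, F A -> b <= total A w.
Proof.
have [A0 FA0] := F_neq0.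
have lb : has_lbound [set total A w | A in F].
  by exists 0 => _ [A FA <-]; exact: total_ge0.
split=> [bZ A FA|bF].
  by apply: le_trans bZ _; apply: ge_inf => //; exists A.
apply: lb_le_inf; first by exists (total A0 w), A0.
by move=> _ [A FA <-]; exact: bF.
Qed.

Lemma passage_time_lt a w : Z w < a -> exists2 A, F A & total A w < a.
Proof.
move=> Za; apply: contrapT => h.
have : a <= Z w by apply/le_passage_time => A FA; rewrite leNgt; apply/negP => ?; apply: h; exists A.
by rewrite leNgt Za.
Qed.

Lemma measurable_passage_time : measurable_fun setT Z.
Proof.
apply: (measurability (@RGenCInfty.G R)) => [|/= _ [_] [b] -> <-].
  exact: RGenCInfty.measurableE.
have [S [FS SF]] := countable_enumeration F_neq0 F_countable.
rewrite setTI (_ : _ @^-1` _ = \bigcap_n (total (S n) @^-1` `[b, +oo[)).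
  apply: bigcapT_measurable => n; rewrite -[X in measurable X]setTI.
  exact: measurable_total.
apply/seteqP; split => w /=; rewrite in_itv/= andbT.
  by move=> /le_passage_time bw n _ /=; rewrite in_itv/= andbT bw.
move=> bw; apply/le_passage_time => A /SF[n <-].
by have := bw n Logic.I; rewrite /= in_itv/= andbT.
Qed.

Lemma measurable_passage_le a : measurable [set w | Z w <= a].
Proof.
rewrite (_ : [set w | _] = Z @^-1` `]-oo, a]).
  by rewrite -[X in measurable X]setTI; exact: measurable_passage_time.
by apply/seteqP; split => w /=; rewrite in_itv.
Qed.

Lemma measurable_passage_ge b : measurable [set w | b <= Z w].
Proof.
rewrite (_ : [set w | _] = Z @^-1` `[b, +oo[).
  by rewrite -[X in measurable X]setTI; exact: measurable_passage_time.
by apply/seteqP; split => w /=; rewrite in_itv/= andbT.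
Qed.

(** The first [n.+1] sets involve finitely many edges, so the finite bound applies to them. Their
    smallest sum is at least [Z], so [b <= Z w] implies the corresponding finite event. *)
Lemma two_sided_initial_segment (S : nat -> set I) n a b l :
  (forall m, F (S m)) -> 0 <= l <= 2^-1 ->
  fine (P [set w | exists m : 'I_n.+1, total (S m) w <= a]) * fine (P [set w | b <= Z w]) <=
  expR (64 * r * l ^+ 2 - l * (b - a)).
Proof.
move=> FS l01.
pose J := fset_set (\bigcup_(m in [set: 'I_n.+1]) S m).
have fU : finite_set (\bigcup_(m in [set: 'I_n.+1]) S m).
  by apply: bigcup_finite => // m _; exact: F_finite.
have JE : [set` J] `<=` E.
  move=> i; rewrite /= in_fset_set// => /set_mem[m _]; exact: F_sub.
have SJ (m : 'I_n.+1) : S m `<=` [set` J].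
  by move=> i Si; rewrite /= in_fset_set//; apply/mem_set; exists m.
pose A (m : 'I_n.+1) := [set j : J | `[< S m (val j) >]]%SET.
have AE (m : 'I_n.+1) w : total (S m) w = \sum_(j in A m) X (val j) w.
  rewrite /total fsbig_finite; last exact: F_finite.
  by rewrite (big_fset_set_sub _ (fun e => X e w))//; exact: F_finite.
have cardA m : #|A m|%:R <= r.
  rewrite -sum1_card (big_fset_set_sub _ (fun=> 1%N))//; last exact: F_finite.
  by rewrite sum1_size F_card.
have := two_sided_finite_family (X := fun j : J => X (val j))
  (fun j w => X0 (JE _ (valP j)) w) (mutually_independent_fset indep JE)
  (fun j => exp_moment (JE _ (valP j))) cardA a b l01.
apply: le_trans.
rewrite (_ : [set w | exists m : 'I_n.+1, total (S m) w <= a] =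
    [set w | exists m, \sum_(j in A m) X (val j) w <= a]); last first.
  by apply/seteqP; split => w [m wm]; exists m; rewrite ?AE // -AE.
rewrite ler_wpM2l ?fine_probability_ge0// fine_probability_le//.
- exact: measurable_passage_ge.
- exact: measurable_high.
- by move=> w /= /le_passage_time bw m; rewrite -AE bw.
Qed.

Lemma two_sided_passage a b l : 0 <= l <= 2^-1 ->
  fine (P [set w | Z w <= a]) * fine (P [set w | b <= Z w]) <=
  expR (64 * r * l ^+ 2 - l * (b - a)).
Proof.
move=> l01; have /andP[l0 l2] := l01; apply: le_expR_addgt0 => e e0.
have [S [FS SF]] := countable_enumeration F_neq0 F_countable.
(* The infimum need not be attained, so [Z w <= a] only gives some sum below [a + e]; this slack
   costs [l * e <= e] in the exponent. *)
pose L n := [set w | exists m : 'I_n.+1, total (S m) w <= a + e].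
have mL n : measurable (L n).
  rewrite (_ : L n = \bigcup_(m in [set: 'I_n.+1]) total (S m) @^-1` `]-oo, a + e]).
    apply: fin_bigcup_measurable => // m _; rewrite -[X in measurable X]setTI.
    exact: measurable_total.
  apply/seteqP; split => w /=.
    by move=> [m wm]; exists m => //=; rewrite in_itv.
  by move=> [m _ /=]; rewrite in_itv/=; exists m.
have mU : measurable (\bigcup_n L n) by exact: bigcupT_measurable.
set q := fine (P [set w | b <= Z w]).
set C := expR _.
have [->|q0] := eqVneq q 0; first by rewrite mulr0 expR_ge0.
have {}q0 : 0 < q by rewrite lt_neqAle eq_sym q0 fine_probability_ge0.
have PU : fine (P (\bigcup_n L n)) <= C / q.
  rewrite -lee_fin fineK ?fin_num_measure//.
  (* The events [L n] increase, so a bound uniform in [n] passes to their union. *)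
  have cvL : P \o L @ \oo --> P (\bigcup_n L n).
    apply: nondecreasing_cvg_mu => // i j ij; apply/subsetPset => w [m wm].
    by exists (widen_ord (ij : (i.+1 <= j.+1)%N) m).
  rewrite -(cvg_lim _ cvL)//; apply: lime_le; first by apply/cvg_ex; exists (P (\bigcup_n L n)).
  apply: nearW => n /=; rewrite -[leLHS]fineK ?fin_num_measure// lee_fin ler_pdivlMr//.
  apply: le_trans (two_sided_initial_segment n (a + e) b FS l01) _.
  by rewrite ler_expR; have := ler_wpM2r (ltW e0) l2; lra.
rewrite -ler_pdivlMr//; apply: le_trans PU.
apply: fine_probability_le => //; first exact: measurable_passage_le.
move=> w /= Za; have [|A /SF[n <-] An] := @passage_time_lt (a + e) w; first by lra.
by exists n => //; exists ord_max; exact: ltW.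
Qed.

Lemma deviationE M u :
  [set w | u <= `|Z w - M|] = [set w | Z w <= M - u] `|` [set w | M + u <= Z w].
Proof.
apply/seteqP; split => w /=; rewrite ler_normr.
  by move=> /orP[?|?]; [right|left]; lra.
by move=> [?|?]; apply/orP; [right|left]; lra.
Qed.

(** Each tail is paired with the opposite side of the median, of probability at least 1/2, so each
    is at most twice the exponential. *)
Lemma passage_time_deviation M u l : is_median P Z M -> 0 <= l <= 2^-1 ->
  (P [set w | (u <= `|Z w - M|)%R] <= (4 * expR (64 * r * l ^+ 2 - l * u))%:E)%E.
Proof.
move=> [medl medu] l01.
have half (A : set T) : measurable A -> ((2^-1)%:E <= P A)%E -> 2^-1 <= fine (P A).
  by move=> mA; rewrite -{1}[P A]fineK ?fin_num_measure.
have {}medl := half _ (measurable_passage_le M) medl.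
have {}medu := half _ (measurable_passage_ge M) medu.
have up := two_sided_passage M (M + u) l01.
have lo := two_sided_passage (M - u) M l01.
rewrite (_ : M + u - M = u) in up; last by ring.
rewrite (_ : M - (M - u) = u) in lo; last by ring.
rewrite deviationE; have mle := measurable_passage_le (M - u).
have mge := measurable_passage_ge (M + u).
apply: le_trans (measureU2 _ mle mge) _.
rewrite -[X in (X + _)%E]fineK ?fin_num_measure// -[X in (_ + X)%E]fineK ?fin_num_measure//.
rewrite -EFinD lee_fin.
have pu := fine_probability_ge0 P [set w | M + u <= Z w].
have pl := fine_probability_ge0 P [set w | Z w <= M - u].
have := ler_wpM2r pu medl; have := ler_wpM2l pl medu; lra.
Qed.

End CountableFamily.

(** * Transfer of the moment hypothesis and choice of the parameter [l] *)

Lemma expectation_exp_same_distribution (d d' : measure_display)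
    (T : measurableType d) (T' : measurableType d') (R : realType)
    (P : probability T R) (P' : probability T' R)
    (X : {RV P >-> R}) (Y : {RV P' >-> R}) :
  same_distribution X Y ->
  (\int[P]_w (expR (X w))%:E = \int[P']_w (expR (Y w))%:E)%E.
Proof.
move=> XY; have mexp : measurable_fun setT (fun x : R => (expR x)%:E).
  by apply/measurable_EFinP.
have exp0 (x : R) : (0 <= (expR x)%:E)%E by rewrite lee_fin expR_ge0.
rewrite -(ge0_integral_distribution X mexp exp0) -(ge0_integral_distribution Y mexp exp0).
by apply: eq_measure_integral => B mB _; exact: XY.
Qed.

Lemma sup_card_ge (R : realType) (I : choiceType) (F : set (set I)) (A : set I) :
  (sup_card R F < +oo)%E -> F A ->
  finite_set A /\ ((#|` fset_set A|%:R)%:E <= sup_card R F)%E.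
Proof.
move=> Foo FA; have : (counting A <= sup_card R F)%E by apply: ereal_sup_ubound; exists A.
rewrite /counting; case: asboolP => // _ h.
by have := le_lt_trans h Foo; rewrite ltxx.
Qed.

(* F is assumed countable so that the infimum is a random variable and the
   claim holds: over an uncountable family, changing each X_e on a null event
   can change the infimum on an event of positive probability. In the bound,
   r = 0 is covered, since the inverse of 0 in \bar R is +oo. *)
Theorem proposition8p3 (R : realType) :
  exists K1 K2 : R, 0 < K1 /\ 0 < K2 /\
  forall (V : Type) (E : set (set V)),
    simple_graph E ->
  forall (d d' : measure_display)
    (Omega : measurableType d) (P : probability Omega R)
    (Omega' : measurableType d') (P' : probability Omega' R)
    (X : {RV P' >-> R}) (Xe : set V -> {RV P >-> R}),
    mutually_independent E Xe ->
    (forall e, E e -> forall w, 0 <= Xe e w) ->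
    (forall e, E e -> same_distribution (Xe e) X) ->
  forall F : set (set (set V)),
    F !=set0 ->
    countable F ->
    (forall A, F A -> A `<=` E) ->
  let r : \bar R := sup_card R F in
  let Z : Omega -> R := passage_time (fun e => Xe e) F in
    (r < +oo)%E ->
  forall M : R,
    is_median P Z M ->
    ('E_P'[fun w => expR (X w / K1)] <= 2%:E)%E ->
  forall u : R, 0 < u ->
    (P [set w | (u <= `|Z w - M|)%R] <=
     4%:E * expeR (- ((K2^-1)%R%:E * mine ((u ^+ 2)%R%:E / r) u%:E)))%E.
Proof.
(* The exponent [64 * r * l ^+ 2 - l * u] is minimal at [l = u / (128 * r)], with value
   [- u ^+ 2 / (256 * r)]; hence 256. *)
exists 1, 256; split; first exact: ltr01; split; first exact: ltr0n.
move=> V E _ d d' Omega P Omega' P' X Xe indep X0 XeX F F0 Fc FE r Z roo M med mom u u0.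
have r_fin : r = (fine r)%:E.
  have [A FA] := F0; have [_ Ar] := sup_card_ge roo FA.
  rewrite fineK// fin_numE gt_eqF ?(lt_le_trans _ Ar) ?ltNyr//=.
  by rewrite lt_eqF.
have card_le A : F A -> #|` fset_set A|%:R <= fine r.
  by move=> FA; rewrite -lee_fin -r_fin; have [] := sup_card_ge roo FA.
have expXe e : E e -> (\int[P]_w (expR (Xe e w))%:E <= 2%:E)%E.
  move=> Ee; rewrite (expectation_exp_same_distribution (XeX _ Ee)).
  by move: mom; rewrite unlock; under eq_integral do rewrite divr1.
have dev l : 0 <= l <= 2^-1 ->
    (P [set w | (u <= `|Z w - M|)%R] <= (4 * expR (64 * fine r * l ^+ 2 - l * u))%:E)%E.
  apply: (passage_time_deviation indep X0 expXe F0 Fc FE _ card_le) => // A FA.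
  by have [] := sup_card_ge roo FA.
set m := mine _ _.
have exp_le (x y : R) : y <= - (256^-1 * x) -> (m <= x%:E)%E ->
    ((4 * expR y)%:E <= 4%:E * expeR (- ((256^-1)%:E * m)))%E.
  move=> yx mx; rewrite EFinM lee_wpmul2l// -[(expR y)%:E]/(expeR y%:E) lee_expeR.
  apply: (@le_trans _ _ (- ((256^-1)%:E * x%:E))%E); first by rewrite -EFinM -EFinN lee_fin.
  by rewrite leeN2 lee_wpmul2l// lee_fin.
(* The condition [u <= 64 * fine r] says that the minimizing [l] is at most 1/2; with [0 < u] it
   also forces [0 < fine r]. *)
have [ur|ur] := leP u (64 * fine r).
  have r0 : 0 < fine r by lra.
  pose l := u / (128 * fine r).
  have l01 : 0 <= l <= 2^-1.
    have r128 : 0 < 128 * fine r by lra.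
    by rewrite /l (divr_ge0 (ltW u0) (ltW r128))/= ler_pdivrMr//; lra.
  apply: le_trans (dev l l01) _; apply: (exp_le (u ^+ 2 / fine r)).
    by rewrite le_eqVlt; apply/orP; left; apply/eqP; rewrite /l; field; rewrite gt_eqF.
  by rewrite /m r_fin inver gt_eqF// -EFinM ge_min lexx.
(* Here [64 * fine r < u], so at [l = 1/2] the exponent [16 * fine r - u / 2] is below [- u / 4],
   also when [fine r = 0]. *)
apply: le_trans (dev 2^-1 _) _; first by rewrite lexx andbT.
apply: (exp_le u); last by rewrite ge_min lexx orbT.
by rewrite expr2; lra.
Qed.
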